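(* Let $T>0$, $d\ge 1$, $1\le p<\infty$, and let $\mathcal{R}\subset BV_p(R^d)$ be an integral. Then $\mathcal{R}$ is closed with respect to the norm $\|\cdot\|_\infty$ and $\mathcal{R}$ is $V_p$-decomposable.
   Context: $R^d$ carries the Euclidean norm $\|\cdot\|$. For $f:[0,T]\to R^d$, $\|f\|_\infty=\sup_{t\in[0,T]}\|f(t)\|$, and the Riesz $p$-variation is $V_p(f)=\sup\sum_{i=1}^n \frac{\|f(t_i)-f(t_{i-1})\|^p}{(t_i-t_{i-1})^{p-1}}$, the supremum being over all partitions $0=t_0<t_1<\dots<t_n=T$. $BV_p(R^d)$ is the set of all $f:[0,T]\to R^d$ with $V_p(f)<\infty$. $Conv(R^d)$ is the family of nonempty compact convex subsets of $R^d$. A measurable set-valued function $\Phi$ on $[0,T]$ is $p$-integrably bounded if there is $g\in L^p([0,T])$ with $\sup_{a\in\Phi(t)}\|a\|\le g(t)$ for a.e. $t$. $S_{L^p}(\Phi)=\{\phi\in L^p([0,T],R^d):\phi(t)\in\Phi(t)\text{ for a.e. }t\in[0,T]\}$. A set $\mathcal{R}\subset BV_p(R^d)$ is called an integral if there exist $x_0\in R^d$ and a measurable and $p$-integrably bounded set-valued function $\Phi:[0,T]\to Conv(R^d)$ such that $\mathcal{R}=\{f\in BV_p(R^d): f(\cdot)=x_0+\int_0^{\cdot}\phi(s)\,ds,\ \phi\in S_{L^p}(\Phi)\}$. A set $\Lambda\subset BV_p(R^d)$ is $V_p$-decomposable if for every $f_1,f_2\in\Lambda$ and every $a\in[0,T]$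 the function $f_1\oplus_a f_2$ defined by $(f_1\oplus_a f_2)(t)=f_1(0)+\int_0^t\big(\mathbf{1}_{[0,a)}(s)f_1'(s)+\mathbf{1}_{[a,T]}(s)f_2'(s)\big)ds$, $t\in[0,T]$, belongs to $\Lambda$ (here $f_i'$ is the a.e. derivative of $f_i$). *)

(* Defs.v *)
From HB Require Import structures.
From mathcomp Require Import all_boot all_order all_algebra.
From mathcomp Require Import all_classical all_reals all_analysis.
Set Implicit Arguments.
Unset Strict Implicit.
Unset Printing Implicit Defensive.
Import Order.TTheory GRing.Theory Num.Theory.
Import numFieldNormedType.Exports.
Local Open Scope classical_set_scope.
Local Open Scope ring_scope.

Definition itv0 {R : realType} (T : R) : set R := [set` `[0, T]].

(* The norm that the library puts on ['rV[R]_d] is the maximum norm; it induces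
   the same topology as [enorm], so that the library's [open], [compact] and
   [derive1] have their usual meaning. *)
Definition enorm {R : realType} {d : nat} (x : 'rV[R]_d) : R :=
  Num.sqrt (\sum_(i < d) x 0 i ^+ 2).

(* [R] equipped with the Lebesgue sigma-algebra (the library's default
   sigma-algebra on [R] is the Borel one), which is the domain of
   [completed_lebesgue_measure]. *)
Definition lebesgueType (R : realType) : measurableType _ :=
  caratheodory_type (@wlength R idfun)^*%mu.

Definition leb {R : realType} : {measure set (lebesgueType R) -> \bar R} :=
  @completed_lebesgue_measure R.

Section FunctionsOn0T.
Context {R : realType} {d : nat} (T : R).
Implicit Types f : itv0 T -> 'rV[R]_d.

Definition sup_norm f : \bar R :=
  ereal_sup [set (enorm (f t))%:E | t in [set: itv0 T]].

Definition ext0 f : R -> 'rV[R]_d := 'valL_ (0 : 'rV[R]_d) f.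

Definition riesz_sum (p : R) f (s : seq R) : R :=
  let t := nth 0 (0 :: s) in
  let F := ext0 f in
  \sum_(i < size s)
    enorm (F (t i.+1) - F (t i)) `^ p / (t i.+1 - t i) `^ (p - 1).

(* [itv_partition 0 T s] says that $0 < s_1 < \dots < s_n = T$. *)
Definition riesz_variation (p : R) f : \bar R :=
  ereal_sup [set (riesz_sum p f s)%:E | s in itv_partition 0 T].

Definition BVp (p : R) : set (itv0 T -> 'rV[R]_d) :=
  [set f | (riesz_variation p f < +oo)%E].

(* The derivative at the interior points of $[0,T]$, where it does not depend
   on the extension of [f]. As everywhere in the library, it has a junk value
   where [f] is not differentiable, which is a null set for [f] in [BVp p]. *)
Definition ae_deriv f : R -> 'rV[R]_d := derive1 (ext0 f).

(* $\int_0^t \phi(s)\,ds$, taken coordinatewise. *)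
Definition vint (phi : R -> 'rV[R]_d) (t : R) : 'rV[R]_d :=
  \row_i (\int[leb]_(s in [set` `[0, t]]) (phi s 0 i)).

Definition Lp_on (p : R) (g : lebesgueType R -> R) : Prop :=
  (g \_ (itv0 T)) \in Lfun leb p%:E.

Definition Lp_vec_on (p : R) (phi : lebesgueType R -> 'rV[R]_d) : Prop :=
  (forall i, @measurable_fun _ _ (lebesgueType R) R (itv0 T)
     (fun t => phi t 0 i)) /\
  Lp_on p (fun t => enorm (phi t)).

Definition Conv : set (set 'rV[R]_d) :=
  [set A | [/\ A !=set0, compact A &
    @convex_set R 'rV[R]_d A]].

(* Functions [Phi], [phi], [g] of a measure-theoretic nature are total; only
   their restriction to $[0,T]$ is ever used. *)

Definition set_measurable (Phi : R -> set 'rV[R]_d) : Prop :=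
  forall U : set 'rV[R]_d, open U ->
    @measurable _ (lebesgueType R) [set t | itv0 T t /\ Phi t `&` U !=set0].

Definition p_integrably_bounded (p : R) (Phi : R -> set 'rV[R]_d) : Prop :=
  exists g : R -> R, Lp_on p g /\
    {ae leb, forall t, itv0 T t ->
       (ereal_sup [set (enorm a)%:E | a in Phi t] <= (g t)%:E)%E}.

Definition S_Lp (p : R) (Phi : R -> set 'rV[R]_d) : set (R -> 'rV[R]_d) :=
  [set phi | Lp_vec_on p phi /\ {ae leb, forall t, itv0 T t -> Phi t (phi t)}].

Definition is_integral (p : R) (Lam : set (itv0 T -> 'rV[R]_d)) : Prop :=
  exists (x0 : 'rV[R]_d) (Phi : R -> set 'rV[R]_d),
    [/\ forall t, itv0 T t -> Conv (Phi t),
        set_measurable Phi,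
        p_integrably_bounded p Phi &
        Lam = [set f | BVp p f /\ exists2 phi, S_Lp p Phi phi &
                         forall t, f t = x0 + vint phi (val t)]].

(* Closedness in the space of all functions on $[0,T]$, which implies
   closedness relative to [BVp p]. *)
Definition closed_sup_norm (Lam : set (itv0 T -> 'rV[R]_d)) : Prop :=
  forall f, (forall e : R, 0 < e ->
               exists2 h, Lam h & (sup_norm (fun t => (f t - h t)%R) < e%:E)%E) ->
    Lam f.

Definition oplus (a : R) (f1 f2 : itv0 T -> 'rV[R]_d) : itv0 T -> 'rV[R]_d :=
  fun t => ext0 f1 0 +
    vint (fun s => \1_([set` `[0, a[]) s *: ae_deriv f1 s +
                   \1_([set` `[a, T]]) s *: ae_deriv f2 s) (val t).

Definition Vp_decomposable (Lam : set (itv0 T -> 'rV[R]_d)) : Prop :=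
  forall f1 f2 a, Lam f1 -> Lam f2 -> itv0 T a -> Lam (oplus a f1 f2).

End FunctionsOn0T.

(* Main.v *)
(* Closedness. Let [f] be a uniform limit of primitives of selections of [Phi].
   The increments of its coordinates over [s, t] are bounded by the integral of
   the dominating function [g], so that [f] has a density [psi]: adding the
   primitive of [g] makes a coordinate nondecreasing, and its Stieltjes measure
   has a Radon-Nikodym derivative. For every rational vector [q], the support
   function [sigma_q] of [Phi] satisfies [int_s^t <q, phi> <= int_s^t sigma_q]
   for all selections [phi]; this passes to the limit, and the Lebesgue
   differentiation theorem gives [<q, psi> <= sigma_q] almost everywhere. As
   countably many [q] suffice to separate points from compact convex sets, [psi]
   is a selection of [Phi].
   Decomposability. By the Lebesgue differentiation theorem the derivatives of
   the two functions are almost everywhere the given selections, and switching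
   from one selection to the other at time [a] gives a selection.
   In both cases Jensen's inequality shows that primitives of functions in [L^p]
   have finite Riesz [p]-variation. *)
Require Import Defs.
From HB Require Import structures.
From mathcomp Require Import all_boot all_order all_algebra.
From mathcomp Require Import all_classical all_reals all_analysis.
From mathcomp Require Import measurable_realfun.
From mathcomp Require Import ring lra.
Set Implicit Arguments.
Unset Strict Implicit.
Unset Printing Implicit Defensive.
Import Order.TTheory GRing.Theory Num.Theory.
Import numFieldNormedType.Exports.
Local Open Scope classical_set_scope.
Local Open Scope ring_scope.

(** * Lebesgue versus Borel measurability *)

Section lebesgue_vs_borel.
Context {R : realType}.
Local Notation mu := (@lebesgue_measure R).
Local Notation lam := (@leb R).

Lemma borel_leb_measurable (A : set R) :
  measurable A -> @measurable _ (lebesgueType R) A.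
Proof. exact: sub_caratheodory. Qed.

Lemma lebE (A : set R) : lam A = mu A.
Proof. by []. Qed.

(** Integrals against [leb] and against [lebesgue_measure] are compared as pushforwards along this
    map. *)
Lemma leb_measurable_id :
  measurable_fun [set: lebesgueType R]
    (idfun : lebesgueType R -> measurableTypeR R).
Proof. by move=> _ A mA; rewrite setTI; exact: borel_leb_measurable. Qed.

Lemma borel_leb_measurable_fun d' (T' : measurableType d') (f : R -> T') :
  measurable_fun setT f -> @measurable_fun _ _ (lebesgueType R) T' setT f.
Proof.
move=> mf _ Y mY; rewrite setTI; apply: borel_leb_measurable.
by rewrite -[X in measurable X]setTI; exact: mf.
Qed.

(** The Caratheodory sigma-algebra is the completion of the Borel one. *)
Lemma leb_measurableE (A : set R) : @measurable _ (lebesgueType R) A ->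
  exists B N, [/\ measurable B, mu.-negligible N & A = B `|` N].
Proof.
move=> mA.
have : (completed_algebra_gen mu).-sigma.-measurable A.
  by rewrite completed_caratheodory_measurable.
rewrite g_sigma_completed_algebra_genE => -[B mB [N nN <-]].
by exists B, N.
Qed.

(** A Lebesgue measurable null cover splits into a Borel set and a negligible one; the Borel part is
    null by monotonicity. *)
Lemma leb_negligibleE (A : set R) : lam.-negligible A <-> mu.-negligible A.
Proof.
split=> [[B [mB B0 AB]]|[B [mB B0 AB]]]; last first.
  by exists B; split => //; exact: borel_leb_measurable.
have [C [N [mC nN BE]]] := leb_measurableE mB.
apply: (@negligibleS _ _ _ mu _ _ AB); rewrite BE; apply: negligibleU => //.
apply/negligibleP => //; apply/eqP; rewrite eq_le measure_ge0 andbT.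
suff : (lam C <= lam B)%E by rewrite B0.
apply: le_measure; rewrite ?inE//; first exact: borel_leb_measurable.
by rewrite BE => x; left.
Qed.

Lemma leb_aeE (P : R -> Prop) :
  {ae lam, forall x, P x} <-> {ae mu, forall x, P x}.
Proof. exact: leb_negligibleE. Qed.

(* [f] is set to [0] outside the union over the rationals [q] of the null sets
   by which the sets [f > q] fail to be Borel. *)
Lemma leb_measurable_fun_borel (f : R -> R) :
  @measurable_fun _ _ (lebesgueType R) R setT f ->
  exists2 g : R -> R, measurable_fun setT g &
    {ae lam, forall x, f x = g x}.
Proof.
move=> mf.
have ex (q : rat) : exists B N : set R, [/\ measurable B, measurable N,
    mu N = 0, B `<=` f @^-1` `]ratr q, +oo[ &
    f @^-1` `]ratr q, +oo[ `<=` B `|` N].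
  have mA : @measurable _ (lebesgueType R) (f @^-1` `]ratr q, +oo[).
    by rewrite -[X in measurable X]setTI; exact: mf.
  have [B [M [mB [N [mN N0 MN]] ->]]] := leb_measurableE mA.
  by exists B, N; split => //; exact: setUS.
have [B /choice [N BN]] := choice ex.
pose NN := \bigcup_q N q.
have mNN : measurable NN.
  apply: bigcupT_measurable_rat => q; by have [] := BN q.
have NN0 : mu.-negligible NN.
  rewrite /NN (_ : \bigcup_q N q =
      \bigcup_n (if unpickle n is Some q then N q else set0)); last first.
    apply/seteqP; split=> [x [q _ Nqx]|x [n _]].
      by exists (pickle q); [exact: I|rewrite pickleK].
    by case: unpickle => // q ?; exists q.
  apply: negligible_bigcup => n.
  case: unpickle => [q|]; last exact: negligible_set0.
  by have [_ ? ? _ _] := BN q; exists (N q); split.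
exists (f \_ (~` NN)); last first.
  apply/leb_aeE; apply: negligibleS NN0 => x /= fx.
  by apply: contrapT => NNx; apply: fx; rewrite patchE mem_set.
apply/(measurable_restrictT _ _).1; first exact: measurableC.
apply: (measurability _ (RGenOInfty.measurableE R)) => _ [_ [x ->] <-].
(* Off [NN] the sets [B q] and [f > q] agree, and a rational strictly between [x] and [f y] puts [y]
   into some [B q]. *)
rewrite (_ : _ `&` _ =
    \bigcup_(q in [set q : rat | x <= ratr q]) (~` NN `&` B q)); last first.
  apply/seteqP; split=> [y [NNy /=]|y [q /= xq [NNy By]]].
    rewrite in_itv/= andbT => /rat_in_itvoo[q].
    rewrite in_itv/= => /andP[xq qf]; exists q; first exact: ltW.
    split => //; have [_ _ _ _ /(_ y)] := BN q.
    rewrite /= in_itv/= andbT => /(_ qf)[//|Ny].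
    by exfalso; apply: NNy; exists q.
  split => //=; have [_ _ _ /(_ y By)/= + _] := BN q.
  by rewrite !in_itv/= !andbT; exact: le_lt_trans.
rewrite bigcup_mkcond; apply: bigcupT_measurable_rat => q.
case: ifPn => // _; apply: measurableI; first exact: measurableC.
by have [+ _ _ _ _] := BN q.
Qed.

Lemma leb_ge0_integralE (D : set R) (f : R -> \bar R) :
  measurable D -> measurable_fun D f -> (forall x, D x -> 0 <= f x)%E ->
  (\int[lam]_(x in D) f x = \int[mu]_(x in D) f x)%E.
Proof.
move=> mD mf f0.
rewrite -(ge0_integral_pushforward leb_measurable_id)//.
by move=> x; rewrite inE; exact: f0.
Qed.

Lemma leb_integrableE (f : R -> \bar R) : measurable_fun setT f ->
  lam.-integrable setT f <-> mu.-integrable setT f.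
Proof.
move=> mf; have mf' := borel_leb_measurable_fun mf.
split=> /integrableP[_ foo]; apply/integrableP; split => //; move: foo;
  rewrite leb_ge0_integralE//; exact: measurableT_comp.
Qed.

Lemma leb_integralE (D : set R) (f : R -> \bar R) :
  measurable D -> measurable_fun setT f -> lam.-integrable setT f ->
  (\int[lam]_(x in D) f x = \int[mu]_(x in D) f x)%E.
Proof.
move=> mD mf intf.
rewrite -(integral_pushforward leb_measurable_id mf)//.
by apply: integrableS intf => //; exact: borel_leb_measurable.
Qed.

Lemma leb_RintegralE (D : set R) (f : R -> R) :
  measurable D -> measurable_fun setT f -> lam.-integrable setT (EFin \o f) ->
  \int[lam]_(x in D) f x = \int[mu]_(x in D) f x.
Proof.
move=> mD mf intf; congr fine; apply: leb_integralE => //.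
exact/measurable_EFinP.
Qed.

Lemma leb_ae_sub (P Q : R -> Prop) : (forall x, P x -> Q x) ->
  {ae lam, forall x, P x} -> {ae lam, forall x, Q x}.
Proof.
move=> PQ; apply: filterS => //; exact: (ae_filter_ringOfSetsType lam).
Qed.

Lemma leb_ae_sub2 (P Q S : R -> Prop) : (forall x, P x -> Q x -> S x) ->
  {ae lam, forall x, P x} -> {ae lam, forall x, Q x} -> {ae lam, forall x, S x}.
Proof.
move=> PQ; apply: filterS2 => //; exact: (ae_filter_ringOfSetsType lam).
Qed.

(** Rests on the completeness of [leb]. *)
Lemma leb_ae_eq_measurable (D : set R) (f g : R -> R) :
  {ae lam, forall x, D x -> f x = g x} ->
  @measurable_fun _ _ (lebesgueType R) R D f ->
  @measurable_fun _ _ (lebesgueType R) R D g.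
Proof.
move=> fg /measurable_EFinP mf; apply/measurable_EFinP.
apply: (ae_measurable_fun (@completed_lebesgue_measure_is_complete R)) mf.
by apply: leb_ae_sub fg => x fg Dx; rewrite /= fg.
Qed.

Lemma leb_ae_eq_integral (D : set (lebesgueType R)) (f g : R -> R) :
  measurable D -> {ae lam, forall x, D x -> f x = g x} ->
  @measurable_fun _ _ (lebesgueType R) R D f ->
  \int[lam]_(x in D) f x = \int[lam]_(x in D) g x.
Proof.
move=> mD fg mf; have mg := leb_ae_eq_measurable fg mf.
congr fine; apply: ae_eq_integral; [exact: mD|exact/measurable_EFinP..|].
by apply: leb_ae_sub fg => x fg Dx; rewrite /= fg.
Qed.

Lemma leb_ae_eq_integrable (D : set (lebesgueType R)) (f g : R -> R) :
  measurable D -> {ae lam, forall x, D x -> f x = g x} ->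
  lam.-integrable D (EFin \o f) -> lam.-integrable D (EFin \o g).
Proof.
move=> mD fg /integrableP[/measurable_EFinP mf foo]; apply/integrableP.
have mg := leb_ae_eq_measurable fg mf.
split; first exact/measurable_EFinP.
rewrite (_ : (\int[_]_(x in _) _ =
    \int[lam]_(x in D) `|(EFin \o f) x|)%E); last first.
  apply: ge0_ae_eq_integral; [exact: mD| | | | |].
  - by apply: measurableT_comp => //; exact/measurable_EFinP.
  - by apply: measurableT_comp => //; exact/measurable_EFinP.
  - by move=> x _; exact: abse_ge0.
  - by move=> x _; exact: abse_ge0.
  - by apply: leb_ae_sub fg => x fg Dx; rewrite /= fg.
exact: foo.
Qed.

(** Gives access to the theorems on Borel functions: differentiation of primitives and existence of
    densities. *)
Lemma leb_integrable_borel (f : R -> R) : lam.-integrable setT (EFin \o f) ->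
  exists g : R -> R, [/\ measurable_fun setT g, mu.-integrable setT (EFin \o g) &
    {ae lam, forall x, f x = g x}].
Proof.
move=> intf; have /measurable_EFinP mf := measurable_int _ intf.
have [g mg fg] := leb_measurable_fun_borel mf.
exists g; split=> //; apply/leb_integrableE; first exact/measurable_EFinP.
by apply: leb_ae_eq_integrable intf => //; apply: leb_ae_sub fg => x ->.
Qed.
End lebesgue_vs_borel.

(** * Densities of absolutely continuous functions *)

Section stieltjes.
Context {R : realType}.
Local Notation mu := (@lebesgue_measure R).

Lemma lebesgue_stieltjes_ocitv (F : cumulative R R) (s t : R) : s <= t ->
  lebesgue_stieltjes_measure F `]s, t]%classic = (F t - F s)%:E.
Proof.
move=> st; rewrite /lebesgue_stieltjes_measure /measure_extension.
rewrite measurable_mu_extE/=; last exact: is_ocitv.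
exact: wlength_itv_bnd.
Qed.

(** By uniqueness of the extension it suffices to compare both sides on half-open intervals, where
    they are increments. *)
Lemma lebesgue_stieltjesD (F F1 F2 : cumulative R R) (A : set R) :
  (forall t, F t = F1 t + F2 t) -> measurable A ->
  lebesgue_stieltjes_measure F A =
  (lebesgue_stieltjes_measure F1 A + lebesgue_stieltjes_measure F2 A)%E.
Proof.
move=> FE mA; rewrite -measure_addE.
apply: lebesgue_stieltjes_measure_unique => // X /ocitvP[->|[[s t] /= st ->]].
  by rewrite !measure0.
apply: etrans (esym (measure_addE _ _ _)).
rewrite lebesgue_stieltjes_ocitv ?ltW// !FE opprD addrACA EFinD.
by congr (_ + _)%E; apply/esym/lebesgue_stieltjes_ocitv/ltW.
Qed.

(** The indefinite integral of [g] is a measure because [g] is nonnegative, and it agrees with the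
    Stieltjes measure on half-open intervals. *)
Lemma lebesgue_stieltjes_integral (F : cumulative R R) (g : R -> R) (A : set R) :
  mu.-integrable setT (EFin \o g) -> (forall x, 0 <= g x) ->
  (forall s t, s <= t -> F t - F s = \int[mu]_(x in `]s, t]) g x) ->
  measurable A ->
  lebesgue_stieltjes_measure F A = (\int[mu]_(x in A) (g x)%:E)%E.
Proof.
move=> intg g0 FE mA.
have intgS B : measurable B -> mu.-integrable B (EFin \o g).
  by move=> mB; exact: integrableS intg.
have nu0 E : (0 <= induced_charge intg E)%E.
  by apply: integral_ge0 => x _; rewrite lee_fin.
apply: (lebesgue_stieltjes_measure_unique (mu := measure_of_charge _ nu0)) => // X.
move=> /ocitvP[->|[[s t] /= st ->]]; first by rewrite !measure0.
rewrite lebesgue_stieltjes_ocitv ?ltW// FE ?ltW// fineK//.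
by apply: integrable_fin_num => //; exact: intgS.
Qed.

(** Absolute continuity of the integral: short intervals carry little mass of [|g|]. *)
Lemma integral_itv_continuous (g H : R -> R) :
  mu.-integrable setT (EFin \o g) ->
  (forall s t, s <= t -> `|H t - H s| <= \int[mu]_(x in `]s, t]) `|g x|) ->
  continuous H.
Proof.
move=> intg Hg x; apply/cvgrPdist_lt => e e0.
have [d [d0 dg]] := integral_normr_continuous intg e0.
have small s t : s <= t -> t - s < d -> `|H t - H s| < e.
  move=> st td; apply: le_lt_trans (Hg _ _ st) _; apply: dg => //.
  have mu_st : (mu `]s, t]%classic <= (t - s)%:E)%E.
    rewrite lebesgue_measure_itv/= lte_fin; case: ifPn => _.
      by rewrite -EFinB.
    by rewrite lee_fin subr_ge0.
  by apply: le_lt_trans mu_st _; rewrite lte_fin.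
near=> y.
have xy : `|x - y| < d by near: y; apply: cvgr_dist_lt.
have [yx|xy'] := leP y x.
  by apply: small => //; rewrite -(ger0_norm (_ : 0 <= x - y))// subr_ge0.
rewrite distrC; apply: small; first exact: ltW.
by rewrite -(ger0_norm (_ : 0 <= y - x)) ?subr_ge0 1?ltW// distrC.
Unshelve. all: by end_near. Qed.

(* [H + G] and [G - H], with [G] the primitive of [|g|], are nondecreasing, and
   their Stieltjes measures add up to the one with density [2 |g|]; hence the
   former has a Radon-Nikodym derivative. *)
Lemma integral_itv_density (g H : R -> R) : mu.-integrable setT (EFin \o g) ->
  (forall s t, s <= t -> `|H t - H s| <= \int[mu]_(x in `]s, t]) `|g x|) ->
  exists2 psi : R -> R, mu.-integrable setT (EFin \o psi) &
    forall s t, s <= t -> H t - H s = \int[mu]_(x in `]s, t]) psi x.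
Proof.
move=> intg Hg; pose a x := `|g x|.
have inta : mu.-integrable setT (EFin \o a) by exact: integrable_norm.
have intaS A : measurable A -> mu.-integrable A (EFin \o a).
  by move=> mA; exact: integrableS inta.
pose G t := \int[mu]_(x in `]-oo, t]) a x.
have GB s t : s <= t -> G t - G s = \int[mu]_(x in `]s, t]) a x.
  by move=> st; apply: Rintegral_itvB => //; exact: intaS.
have a0 x : 0 <= a x by exact: normr_ge0.
have cH : continuous H by exact: integral_itv_continuous Hg.
have cG : continuous G.
  apply: (integral_itv_continuous intg) => s t st; rewrite GB// ger0_norm//.
  exact: Rintegral_ge0.
have HG s t : s <= t -> `|H t - H s| <= G t - G s by move=> st; rewrite GB// Hg.
have ndF : nondecreasing (H \+ G).
  by move=> s t /HG; rewrite /= ler_norml => /andP[+ _]; lra.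
have ndF' : nondecreasing (G \- H).
  by move=> s t /HG; rewrite /= ler_norml => /andP[_]; lra.
have ndG2 : nondecreasing (G \+ G).
  by move=> s t st; have := ndF s t st; have := ndF' s t st; rewrite /=; lra.
have rcF : right_continuous (H \+ G).
  by apply: right_continuousW => x; apply: cvgD; [exact: cH|exact: cG].
have rcF' : right_continuous (G \- H).
  by apply: right_continuousW => x; apply: cvgB; [exact: cG|exact: cH].
have rcG2 : right_continuous (G \+ G).
  by apply: right_continuousW => x; apply: cvgD; exact: cG.
pose F : cumulative R R := HB.pack (H \+ G) (isCumulative.Build _ _ _ _ ndF rcF).
pose F' : cumulative R R :=
    HB.pack (G \- H) (isCumulative.Build _ _ _ _ ndF' rcF').
pose G2 : cumulative R R :=
    HB.pack (G \+ G) (isCumulative.Build _ _ _ _ ndG2 rcG2).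
pose nu := lebesgue_stieltjes_measure F.
have inta2 : mu.-integrable setT (EFin \o (a \+ a)).
  rewrite (_ : EFin \o _ = (EFin \o a) \+ (EFin \o a))%E//.
  exact: integrableD.
have nu_le A : measurable A -> (nu A <= \int[mu]_(x in A) (a x + a x)%:E)%E.
  move=> mA; rewrite -(@lebesgue_stieltjes_integral G2 (a \+ a))//=.
  - rewrite (@lebesgue_stieltjesD G2 F F')//; first by rewrite leeDl.
    by move=> t /=; ring.
  - by move=> x; rewrite addr_ge0.
  - by move=> s t st; rewrite opprD addrACA GB// RintegralD//; exact: intaS.
have nu_fin : fin_num_fun nu.
  move=> A mA; rewrite ge0_fin_numE//; apply: le_lt_trans (nu_le _ mA) _.
  rewrite -ge0_fin_numE; last first.
    by apply: integral_ge0 => x _; rewrite lee_fin addr_ge0.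
  by apply: integrable_fin_num => //; exact: integrableS inta2.
pose nuf : {finite_measure set (measurableTypeR R) -> \bar R} :=
  HB.pack nu (Measure_isFinite.Build _ _ _ nu nu_fin).
have numu : nuf `<< mu.
  apply/null_content_dominatesP => A mA A0.
  apply/eqP; rewrite eq_le measure_ge0 andbT; apply: le_trans (nu_le _ mA) _.
  rewrite null_set_integral//; apply: measurable_funTS.
  exact: measurable_int inta2.
have [f [f0 ffin intf nuE]] := radon_nikodym_sigma_finite numu.
(* [f] is the density of [H + G] and [a] that of [G]. *)
exists ((fine \o f) \- a).
  rewrite (_ : EFin \o _ = f \- (EFin \o a))%E; first exact: integrableB.
  by apply/funext => x; rewrite /= EFinB fineK.
have intf' : mu.-integrable setT (EFin \o (fine \o f)).
  by rewrite (_ : EFin \o _ = f)//; apply/funext => x; rewrite /= fineK.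
move=> s t st; rewrite RintegralB//; last 2 first.
- by apply: integrableS intf'.
- exact: intaS.
rewrite -GB//; apply/eqP; rewrite -subr_eq opprB; apply/eqP.
have := nuE `]s, t]%classic (measurable_itv _).
rewrite /= /nu lebesgue_stieltjes_ocitv//= /Rintegral.
under [X in _ -> _ = fine X]eq_integral do rewrite /= fineK//.
by move=> <- /=; ring.
Qed.
End stieltjes.

(** * Primitives and Lebesgue differentiation for [leb] *)

Section leb_primitive.
Context {R : realType}.
Local Notation mu := (@lebesgue_measure R).
Local Notation lam := (@leb R).
Implicit Types (k g h : R -> R) (a b s t x : R).

Lemma leb_measurable_itv (i : interval R) :
  @measurable _ (lebesgueType R) [set` i].
Proof. exact: borel_leb_measurable. Qed.

Lemma leb_ae_neq a : {ae lam, forall x, x != a}.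
Proof.
apply/leb_aeE; exists [set a]; split => //; first exact: lebesgue_measure_set1.
by move=> x /= /negP; rewrite negbK => /eqP.
Qed.

Lemma leb_Rintegral_itvB k T s t : lam.-integrable `[0, T] (EFin \o k) ->
  0 <= s -> s <= t -> t <= T ->
  \int[lam]_(x in `[0, t]) k x - \int[lam]_(x in `[0, s]) k x =
  \int[lam]_(x in `]s, t]) k x.
Proof.
move=> intk s0 st tT.
rewrite (@itv_bndbnd_setU _ _ (BLeft 0) (BRight s) (BRight t))//.
rewrite Rintegral_setU; [by rewrite addrC addKr|exact: leb_measurable_itv..| |].
- apply: integrableS intk; [exact: leb_measurable_itv| |].
    by apply: measurableU; exact: leb_measurable_itv.
  rewrite -itv_bndbnd_setU//; apply: subset_itvl; rewrite bnd_simp//.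
- by apply/disj_setPS => y [/=]; rewrite 2!in_itv/= => /andP[_ ys] /andP[]; lra.
Qed.

(** A Borel representative has the same primitive, and its values agree with those of [k] almost
    everywhere. *)
Lemma leb_FTC1 k : lam.-integrable setT (EFin \o k) ->
  {ae lam, forall x, 0 < x ->
    derivable (fun t => \int[lam]_(y in `[0, t]) k y) x 1 /\
    derive1 (fun t => \int[lam]_(y in `[0, t]) k y) x = k x}.
Proof.
move=> intk; have [g [mg intg kg]] := leb_integrable_borel intk.
have locg : locally_integrable [set: R] g.
  by apply: open_integrable_locally => //; exact: openT.
have intgS y : mu.-integrable `[0, y] (EFin \o g) by exact: integrableS intg.
have /leb_aeE := FTC1 intgS locg.
have -> : (fun t => \int[lam]_(y in `[0, t]) k y) =
          (fun t => \int[mu]_(y in `[0, t]) g y).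
  apply/funext => t; rewrite -leb_RintegralE//; last first.
    apply/leb_integrableE => //; exact/measurable_EFinP.
  apply: leb_ae_eq_integral; first exact: leb_measurable_itv.
    by apply: leb_ae_sub kg => x ->.
  apply/measurable_EFinP; apply: measurable_funTS; exact: measurable_int intk.
apply: leb_ae_sub2 kg => x -> /=; by rewrite lte_fin.
Qed.

(** At almost every interior point [k x] is the limit of difference quotients of the primitive, and
    these are nonnegative. The end points form a null set; removing them leaves room on both
    sides. *)
Lemma leb_integral_ge0_ae k T : lam.-integrable setT (EFin \o k) ->
  (forall s t, 0 <= s -> s <= t -> t <= T -> 0 <= \int[lam]_(x in `]s, t]) k x) ->
  {ae lam, forall x, 0 <= x <= T -> 0 <= k x}.
Proof.
move=> intk k0.
have n0T : {ae lam, forall x, x != 0 /\ x != T}.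
  exact: leb_ae_sub2 (leb_ae_neq 0) (leb_ae_neq T).
apply: leb_ae_sub2 n0T (leb_FTC1 intk) => x [x0 xT] + /andP[le0x lexT].
have x_gt0 : 0 < x by rewrite lt_def x0.
have xltT : x < T by rewrite lt_def eq_sym xT.
move=> /(_ x_gt0)[dK <-]; rewrite derive1E; apply: limr_ge; first exact: dK.
have intkT : lam.-integrable `[0, T] (EFin \o k).
  by apply: integrableS intk => //; exact: leb_measurable_itv.
near=> e.
have ex : `|e| < x by near: e; apply: dnbhs0_lt.
have eT : `|e| < T - x by near: e; apply: dnbhs0_lt; rewrite subr_gt0.
move: ex eT; rewrite !ltr_norml => /andP[e1 e2] /andP[e3 e4].
rewrite /= [e *: _]mulr1; set D := _ - _; suff : 0 <= e^-1 * D by [].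
have [e0|e0] := leP 0 e.
  rewrite mulr_ge0 ?invr_ge0// /D (leb_Rintegral_itvB intkT); [apply: k0|..]; lra.
(* For a negative step both the increment and its denominator change sign. *)
rewrite -(mulrNN e^-1) -invrN mulr_ge0 ?invr_ge0 ?oppr_ge0 ?(ltW e0)//.
rewrite -oppr_ge0 /D opprB (leb_Rintegral_itvB intkT); [apply: k0|..]; lra.
Unshelve. all: by end_near. Qed.

Lemma leb_itv_density g h T : 0 <= T -> lam.-integrable setT (EFin \o g) ->
  (forall s t, 0 <= s -> s <= t -> t <= T ->
     `|h t - h s| <= \int[lam]_(x in `]s, t]) g x) ->
  exists2 psi, lam.-integrable setT (EFin \o psi) &
    forall t, 0 <= t -> t <= T -> h t = h 0 + \int[lam]_(x in `[0, t]) psi x.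
Proof.
move=> T0 intg hg; have [g' [mg' intg' gg']] := leb_integrable_borel intg.
(* Clamping the time to [[0, T]] makes [h] constant outside, so that the density result on the whole
   line applies. *)
pose c t := Num.min (Num.max t 0) T.
have cE t : 0 <= t -> t <= T -> c t = t.
  by move=> t0 tT; rewrite /c max_l// min_l.
have [psi intpsi psiE] : exists2 psi, mu.-integrable setT (EFin \o psi) &
    forall s t, s <= t -> h (c t) - h (c s) = \int[mu]_(x in `]s, t]) psi x.
  apply: (integral_itv_density intg') => s t st.
  have c0 u : 0 <= c u by rewrite /c le_min le_max lexx orbT.
  have cT u : c u <= T by rewrite /c ge_min lexx orbT.
  have cst : c s <= c t.
    by rewrite le_min cT andbT ge_min ge_max !le_max st lexx orbT.
  apply: le_trans (hg _ _ (c0 s) cst (cT t)) _.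
  have -> : \int[lam]_(x in `]c s, c t]) g x = \int[mu]_(x in `]c s, c t]) g' x.
    rewrite -leb_RintegralE//; last first.
      by apply/leb_integrableE => //; exact/measurable_EFinP.
    apply: leb_ae_eq_integral; first exact: leb_measurable_itv.
      by apply: leb_ae_sub gg' => x ->.
    by apply/measurable_EFinP; apply: measurable_funTS; exact: measurable_int intg.
  have intg'S A : measurable A -> mu.-integrable A (EFin \o g').
    by move=> mA; exact: integrableS intg'.
  apply: (@le_trans _ _ (\int[mu]_(x in `]c s, c t]) `|g' x|)).
    apply: le_Rintegral => //; first exact: intg'S.
      by apply: integrable_norm; exact: intg'S.
    by move=> x _; exact: ler_norm.
  apply: fine_le.
  - by apply: integrable_fin_num => //; apply: integrable_norm; exact: intg'S.
  - by apply: integrable_fin_num => //; apply: integrable_norm; exact: intg'S.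
  apply: ge0_subset_integral => //.
    by apply/measurable_EFinP/measurableT_comp => //; exact: measurable_funTS.
  (* []c s, c t]] lies in []s, t]]: a point of it is positive and at most [T], so that clamping does
     not affect its comparison with [s] and [t]. *)
  move=> y; rewrite /= !in_itv/= => /andP[sy yt].
  have := sy; rewrite gt_min gt_max => /orP[/andP[-> y0]|]; last first.
    by move=> /lt_le_trans /(_ (le_trans yt (cT t))); rewrite ltxx.
  by have := yt; rewrite le_min le_max [_ <= 0]leNgt y0 orbF => /andP[->].
have mpsi : measurable_fun setT psi.
  by apply/measurable_EFinP; exact: measurable_int intpsi.
exists psi; first by apply/leb_integrableE => //; exact/measurable_EFinP.
move=> t t0 tT; rewrite leb_RintegralE//; last first.
  by apply/leb_integrableE => //; exact/measurable_EFinP.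
rewrite -Rintegral_itv_obnd_cbnd; last exact: integrableS intpsi.
by rewrite -psiE// !cE// addrC subrK.
Qed.
End leb_primitive.

(** * Separation of a point from a compact convex set *)

Section convex_separation.
Context {R : realType} {d : nat}.
Implicit Types (x y u v a b : 'rV[R]_d) (A : set 'rV[R]_d).

Definition dotp u a : R := \sum_(i < d) u 0 i * a 0 i.

Lemma dotpDl u v a : dotp (u + v) a = dotp u a + dotp v a.
Proof. by rewrite -big_split; apply: eq_bigr => i _; rewrite /= mxE mulrDl. Qed.

Lemma dotpC u a : dotp u a = dotp a u.
Proof. by apply: eq_bigr => i _; rewrite mulrC. Qed.

Lemma dotpZl (c : R) u a : dotp (c *: u) a = c * dotp u a.
Proof. by rewrite mulr_sumr; apply: eq_bigr => i _; rewrite mxE mulrA. Qed.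

Lemma dotpNl u a : dotp (- u) a = - dotp u a.
Proof. by rewrite -scaleN1r dotpZl mulN1r. Qed.

Lemma dotpBl u v a : dotp (u - v) a = dotp u a - dotp v a.
Proof. by rewrite dotpDl dotpNl. Qed.

Lemma dotpBr u a b : dotp u (a - b) = dotp u a - dotp u b.
Proof. by rewrite dotpC dotpBl !(dotpC _ u). Qed.

Lemma dotpDr u a b : dotp u (a + b) = dotp u a + dotp u b.
Proof. by rewrite dotpC dotpDl !(dotpC _ u). Qed.

Lemma dotp_subZ (l : R) u v :
  dotp (u - l *: v) (u - l *: v) =
  dotp u u - 2 * (l * dotp u v) + l * (l * dotp v v).
Proof.
rewrite dotpBr !dotpBl !dotpZl !(dotpC _ (l *: v)) !dotpZl (dotpC v u).
by ring.
Qed.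

Lemma dotp_ge0 u : 0 <= dotp u u.
Proof. by apply: sumr_ge0 => i _; rewrite -expr2 sqr_ge0. Qed.

Lemma dotp_eq0 u : (dotp u u == 0) = (u == 0).
Proof.
apply/eqP/eqP => [|->]; last by apply: big1 => i _; rewrite mxE mul0r.
move=> /psumr_eq0P u0; apply/rowP => i; rewrite mxE.
by apply/eqP; rewrite -sqrf_eq0 expr2 u0// => j _; rewrite -expr2 sqr_ge0.
Qed.

Lemma continuous_dotp u : continuous (dotp u).
Proof.
apply: continuous_big => [|i _ a]; first exact: add_continuous.
by apply: continuousM; [exact: cst_continuous|exact: coord_continuous].
Qed.

Lemma dotp_le_bounded u a (e M : R) : 0 <= e ->
  (forall i, `|u 0 i| <= e) -> (forall i, `|a 0 i| <= M) ->
  dotp u a <= d%:R * (e * M).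
Proof.
move=> e0 ue aM; rewrite (_ : d%:R * _ = \sum_(i < d) (e * M)); last first.
  by rewrite sumr_const card_ord mulr_natl.
apply: ler_sum => i _; apply: le_trans (ler_norm _) _.
by rewrite normrM ler_pM.
Qed.

Lemma compact_coord_bounded A : compact A ->
  exists2 M : R, 0 <= M & forall a i, A a -> `|a 0 i| <= M.
Proof.
move=> /compact_bounded[N [_ AN]].
have [N0|N0] := leP 0 N.
  exists (N + 1); first lra.
  move=> a i /(AN (N + 1) ltac:(lra)) /=; apply: le_trans.
  by rewrite [leRHS]/Num.Def.normr/= mx_normrE; apply: (le_bigmax _ _ (0, i)).
exists 0; first exact: lexx.
move=> a i /(AN 0 N0) /=; apply: le_trans.
by rewrite [leRHS]/Num.Def.normr/= mx_normrE; apply: (le_bigmax _ _ (0, i)).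
Qed.

(** Compactness gives a point [b] of [A] nearest to [x]. If the angle at [b] towards some [a] were
    acute, a small step from [b] to [a] would come closer to [x]. *)
Lemma convex_nearest A x : A !=set0 -> compact A ->
  @convex_set R 'rV[R]_d A ->
  exists2 b, A b & forall a, A a -> dotp (x - b) (a - b) <= 0.
Proof.
move=> A0 cA cvA.
have cf : {within A, continuous (fun a => dotp (x - a) (x - a))}.
  apply: continuous_subspaceT.
  apply: continuous_big => [|i _ a]; first exact: add_continuous.
  have cx : {for a, continuous (fun b : 'rV[R]_d => (x - b) 0 i)}.
    rewrite (_ : (fun _ => _) = (fun b : 'rV[R]_d => x 0 i - b 0 i)); last first.
      by apply/funext => b; rewrite !mxE.
    by apply: continuousB; [exact: cst_continuous|exact: coord_continuous].
  by apply: continuousM; exact: cx.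
have [b /set_mem Ab bmin] := compact_EVT_min A0 cA cf.
exists b => // a Aa; rewrite leNgt; apply/negP => ba.
have [D0|] := ltP 0 (dotp (a - b) (a - b)); last first.
  rewrite le_eqVlt ltNge dotp_ge0 orbF dotp_eq0 => /eqP ab.
  by move: ba; rewrite ab dotpC /dotp big1 ?ltxx// => i _; rewrite mxE mul0r.
set D := dotp (a - b) (a - b) in D0; set s := dotp (x - b) (a - b) in ba.
(* The step changes the squared distance by [- 2 * (l * s) + l * (l * D)], which is at most
   [- (l * s)] once [l * D <= s]; [l <= 1] keeps the new point in [A]. *)
pose l := Num.min 1 (s / D).
have l0 : 0 < l by rewrite lt_min ltr01/= divr_gt0.
have l1 : l <= 1 by rewrite ge_min lexx.
have lD : l * D <= s by rewrite -ler_pdivlMr// ge_min lexx orbT.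
have : (b + l *: (a - b)) \in A.
  have := cvA a b (Itv01 (ltW l0) l1) (mem_set Aa) (mem_set Ab).
  congr (is_true (_ \in A)).
  by apply/rowP => i; rewrite !mxE /unstable.onem /=; ring.
move=> /bmin; apply/negP; rewrite -ltNge.
rewrite opprD addrA dotp_subZ -/D -/s.
have : l * (l * D) <= l * s by rewrite ler_pM2l.
have : 0 < l * s by rewrite mulr_gt0.
lra.
Qed.

(* Strict separation of a point from a compact convex set is an open condition
   on the functional, so that rational functionals suffice. *)
Lemma convex_rat_separation A x : A !=set0 -> compact A ->
  @convex_set R 'rV[R]_d A ->
  (forall q : 'rV[rat]_d, dotp (map_mx ratr q) x <=
     sup [set dotp (map_mx ratr q) a | a in A]) -> A x.
Proof.
move=> A0 cA cvA Hq; have [b Ab bA] := convex_nearest x A0 cA cvA.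
have [->//|xb] := eqVneq x b; exfalso.
have D0 : 0 < dotp (x - b) (x - b).
  by rewrite lt_def dotp_eq0 subr_eq0 xb dotp_ge0.
set D := dotp (x - b) (x - b) in D0.
have [M M0 AM] := compact_coord_bounded cA.
have [N N0 xN] := compact_coord_bounded (@compact_set1 _ x).
(* Replacing [x - b] by a vector within [e] of it in each coordinate raises the product with [a - x]
   by at most [d * (e * (M + N))], less than [D / 2]. The added [1] keeps the denominator
   positive. *)
pose e := D / 2 / (d%:R * (M + N) + 1).
have K0 : 0 < d%:R * (M + N) + 1.
  by rewrite ltr_wpDl// mulr_ge0// addr_ge0.
have e0 : 0 < e by rewrite divr_gt0// divr_gt0.
have eK : d%:R * (e * (M + N)) < D / 2.
  have <- : e * (d%:R * (M + N) + 1) = D / 2 by rewrite /e divfK// gt_eqF.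
  by rewrite [ltLHS]mulrCA ltr_pM2l // ltrDl.
have /choice[r rE] (i : 'I_d) : exists r : rat, `|ratr r - (x - b) 0 i| <= e.
  have [r] := @rat_in_itvoo R ((x - b) 0 i - e) ((x - b) 0 i + e) ltac:(lra).
  by rewrite in_itv/= => r_; exists r; rewrite ler_distl; lra.
pose q : 'rV[rat]_d := \row_i r i.
have := Hq q; apply/negP; rewrite -ltNge.
apply: (@le_lt_trans _ _ (dotp (map_mx ratr q) x - D / 2)); last first.
  by rewrite ltrBlDr ltrDl divr_gt0.
apply: ge_sup; first by have [a Aa] := A0; exists (dotp (map_mx ratr q) a), a.
move=> _ [a Aa <-].
rewrite [leRHS]addrC -lerBlDr -dotpBr -[map_mx _ _](subrK (x - b)) dotpDl.
have : dotp (map_mx ratr q - (x - b)) (a - x) <= d%:R * (e * (M + N)).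
  apply: dotp_le_bounded; first exact: ltW.
    by move=> i; rewrite !mxE; have := rE i; rewrite !mxE.
  move=> i; rewrite !mxE; apply: le_trans (ler_normB _ _) _.
  by rewrite lerD// ?AM// xN.
(* The obtuse angle at the nearest point gives the gap [D], half of which survives the rational
   perturbation. *)
have : dotp (x - b) (a - x) <= - D.
  rewrite -[a - x](_ : (a - b) - (x - b) = _); last by rewrite opprB addrA subrK.
  by rewrite dotpBr -/D; have := bA _ Aa; lra.
lra.
Qed.
End convex_separation.

(** * Functions in L^p *)

Section lp_on.
Context {R : realType}.
Local Notation lam := (@leb R).
Implicit Types (k g : R -> R) (T p : R).

(** Extension by zero commutes with the power because [p] is nonzero, so the condition can be read
    on [[0, T]] itself. *)
Lemma Lp_onP T p g : 1 <= p -> Lp_on T p g <->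
  @measurable_fun _ _ (lebesgueType R) R `[0, T] g /\
  lam.-integrable `[0, T] (fun x => (`|g x| `^ p)%:E).
Proof.
move=> p1; have p0 : p != 0 by rewrite gt_eqF// (lt_le_trans ltr01).
have mI : @measurable _ (lebesgueType R) `[0, T].
  exact: leb_measurable_itv.
pose gT := g \_ (`[0, T] : set (lebesgueType R)).
have gTE : (fun x => `|gT x| `^ p) = (fun x => `|g x| `^ p) \_ `[0, T].
  apply/funext => x; rewrite /gT !patchE; case: ifPn => // _.
  by rewrite normr0 powR0.
have NE : (lam.-integrable `[0, T] (fun x => (`|g x| `^ p)%:E)) <->
    lam.-integrable setT (fun x => (`|gT x| `^ p)%:E).
  rewrite (integrable_mkcond _ mI); split; apply: eq_integrable => // x _;
    by rewrite restrict_EFin -gTE.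
split.
- move=> gp; have /andP[/set_mem /= mg _] := gp; split.
    by apply/(measurable_restrictT _ mI).
  by apply/NE; exact: Lfun_integrable gp.
- move=> [mg /NE gp]; apply/andP; split; apply/mem_set => /=.
    exact/(measurable_restrictT _ mI).
  rewrite /finite_norm unlock /Lnorm poweR_lty//.
  by have /integrableP[_] := gp; under eq_integral do
    rewrite gee0_abs ?lee_fin ?powR_ge0//.
Qed.

(** The maximum of [g] and [|k|] equals [g] almost everywhere and dominates [k] at every point. *)
Lemma leb_ae_le_integrable T k g :
  @measurable_fun _ _ (lebesgueType R) R `[0, T] k ->
  {ae lam, forall x, `[0, T]%classic x -> `|k x| <= g x} ->
  lam.-integrable `[0, T] (EFin \o g) -> lam.-integrable `[0, T] (EFin \o k).
Proof.
move=> mk kg intg; have mI := @leb_measurable_itv R `[0, T].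
have intM : lam.-integrable `[0, T] (EFin \o (fun x => Num.max (g x) `|k x|)).
  apply: leb_ae_eq_integrable mI _ intg.
  by apply: leb_ae_sub kg => x /[apply] kg; rewrite max_l.
apply: le_integrable intM => //; first exact/measurable_EFinP.
move=> x _; rewrite /= lee_fin; apply: le_trans (ler_norm _).
by rewrite le_max lexx orbT.
Qed.

(** [[0, T]] has finite measure and [|g| <= 1 + |g| ^ p]. *)
Lemma Lp_on_integrable T p g : 1 <= p -> Lp_on T p g ->
  lam.-integrable `[0, T] (EFin \o g).
Proof.
move=> p1 /(Lp_onP _ _ p1)[mg gp].
apply: (@leb_ae_le_integrable T g (fun x => 1 + `|g x| `^ p)) => //.
  apply: aeW => x _; have [g1|/ltW g1] := leP `|g x| 1.
    by rewrite (le_trans g1)// lerDl powR_ge0.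
  apply: (@le_trans _ _ (`|g x| `^ p)); last by rewrite lerDr.
  by rewrite -[leLHS]powRr1// ler_powR.
rewrite (_ : EFin \o _ = (cst 1%:E) \+ (fun x => (`|g x| `^ p)%:E))%E//.
have mI := @leb_measurable_itv R `[0, T].
apply: integrableD => //; apply/integrableP; split => //.
under eq_integral do rewrite gee0_abs ?lee_fin//.
rewrite integral_cst// mul1e.
rewrite -[X in (X < _)%E]/(lebesgue_measure (`[0, T]%classic : set R)).
by rewrite lebesgue_measure_itv; case: ifPn => _; rewrite ?ltry.
Qed.

Lemma Lp_on_le T p k g : 1 <= p ->
  @measurable_fun _ _ (lebesgueType R) R `[0, T] k ->
  {ae lam, forall x, `[0, T]%classic x -> `|k x| <= g x} ->
  Lp_on T p g -> Lp_on T p k.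
Proof.
move=> p1 mk kg /(Lp_onP _ _ p1)[mg gp]; apply/(Lp_onP _ _ p1); split => //.
apply: (@leb_ae_le_integrable T _ (fun x => `|g x| `^ p)) gp.
  apply: (measurableT_comp (@measurable_powR R p)).
  exact: measurableT_comp mk.
apply: leb_ae_sub kg => x /[apply] kg; rewrite ger0_norm ?powR_ge0//.
apply: ge0_ler_powR; rewrite ?nnegrE//; first by rewrite (le_trans ler01).
exact: le_trans (ler_norm _).
Qed.

Lemma Lp_on_scale T p c g : 1 <= p -> 0 <= c -> Lp_on T p g ->
  Lp_on T p (fun x => c * g x).
Proof.
move=> p1 c0 /(Lp_onP _ _ p1)[mg gp]; apply/(Lp_onP _ _ p1); split.
  exact: measurable_funM.
have mI := @leb_measurable_itv R `[0, T].
apply: eq_integrable (integrableZl mI (c `^ p) gp) => // x _.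
by rewrite normrM powRM// ger0_norm.
Qed.
End lp_on.

(** * The Euclidean norm *)

Section enorm.
Context {R : realType} {d : nat}.
Implicit Types (x : 'rV[R]_d).

Lemma enorm_ge0 x : 0 <= enorm x.
Proof. exact: sqrtr_ge0. Qed.

Lemma coord_le_enorm x i : `|x 0 i| <= enorm x.
Proof.
rewrite -sqrtr_sqr ler_sqrt ?sumr_ge0// => [|j _]; last exact: sqr_ge0.
by rewrite (bigD1 i)//= lerDl sumr_ge0// => j _; exact: sqr_ge0.
Qed.

Lemma enorm_le_sum x : enorm x <= \sum_(i < d) `|x 0 i|.
Proof.
rewrite -(ger0_norm (_ : 0 <= \sum_(i < d) _)); last first.
  by apply: sumr_ge0 => i _.
rewrite -sqrtr_sqr ler_sqrt ?sqr_ge0// [leRHS]expr2 mulr_sumr.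
apply: ler_sum => i _; rewrite -real_normK ?num_real// expr2.
rewrite ler_wpM2r// (bigD1 i)//= lerDl; exact: sumr_ge0.
Qed.

Lemma measurable_fun_enorm d' (S : measurableType d') (D : set S)
    (phi : S -> 'rV[R]_d) :
  (forall i, measurable_fun D (fun t => phi t 0 i)) ->
  measurable_fun D (fun t => enorm (phi t)).
Proof.
move=> mphi.
have msqrt : measurable_fun setT (@Num.sqrt R).
  by apply: continuous_measurable_fun; exact: sqrt_continuous.
apply: (measurableT_comp msqrt); apply: measurable_sum => i.
exact: measurable_funX.
Qed.
End enorm.

(** * Vector-valued functions in [L^p] *)

Section lp_vec_on.
Context {R : realType} {d : nat}.
Local Notation lam := (@leb R).
Implicit Types (phi : R -> 'rV[R]_d) (T p : R).

Lemma Lp_vec_on_coord_integrable T p phi i : 1 <= p -> Lp_vec_on T p phi ->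
  lam.-integrable `[0, T] (fun t => (phi t 0 i)%:E).
Proof.
move=> p1 [mphi /(Lp_on_integrable p1)].
apply: leb_ae_le_integrable; first exact: mphi.
by apply: aeW => t _; exact: coord_le_enorm.
Qed.

Lemma Lp_vec_on_le T p phi (g : R -> R) : 1 <= p ->
  (forall i, @measurable_fun _ _ (lebesgueType R) R `[0, T]
     (fun t => phi t 0 i)) ->
  {ae lam, forall t, `[0, T]%classic t -> enorm (phi t) <= g t} ->
  Lp_on T p g -> Lp_vec_on T p phi.
Proof.
move=> p1 mphi phig gp; split; first exact: mphi.
apply: (Lp_on_le p1 _ _ gp); first exact: measurable_fun_enorm.
by apply: leb_ae_sub phig => t /[apply]; rewrite ger0_norm// enorm_ge0.
Qed.
End lp_vec_on.

(** * Jensen's inequality and finiteness of the Riesz variation *)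

Section jensen.
Context {R : realType}.
Local Notation lam := (@leb R).
Implicit Types (k : R -> R) (T p s t x c : R).

Lemma powR_subr1M p x : 0 <= x -> 1 <= p -> x `^ (p - 1) * x = x `^ p.
Proof.
rewrite le_eqVlt => /predU1P[<-|x0] p1.
  by rewrite mulr0 powR0// gt_eqF// (lt_le_trans ltr01).
rewrite -{2}(powRr1 (ltW x0)) -powRD ?subrK//.
by rewrite (gt_eqF x0) implybT.
Qed.

(* The tangent to [x `^ p] at [c]. *)
Lemma powR_ge_tangent p x c : 1 <= p -> 0 <= x -> 0 <= c ->
  p * (c `^ (p - 1) * x) <= x `^ p + (p - 1) * c `^ p.
Proof.
rewrite le_eqVlt => /predU1P[<-|p1] x0 c0.
  by rewrite subrr powRr0 powRr1// !mul1r mul0r addr0.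
have p0 : 0 < p by rewrite (lt_trans ltr01).
have p10 : 0 < p - 1 by rewrite subr_gt0.
have /(_ _) := @conjugate_powR R x (c `^ (p - 1)) p (p / (p - 1)) x0
  (powR_ge0 _ _) p0 (divr_gt0 p0 p10).
have -> : p^-1 + (p / (p - 1))^-1 = 1 by field; rewrite !gt_eqF.
move=> /(_ erefl); rewrite -powRrM.
have -> : (p - 1) * (p / (p - 1)) = p by field; rewrite gt_eqF.
rewrite -(ler_pM2l p0) [x * _]mulrC => /le_trans; apply.
by rewrite le_eqVlt; apply/orP; left; apply/eqP; field; rewrite !gt_eqF.
Qed.

Lemma leb_itvoc s t : s <= t -> lam `]s, t]%classic = (t - s)%:E.
Proof.
move=> st; rewrite lebE lebesgue_measure_itv/= lte_fin lt_neqAle st andbT.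
by case: eqVneq => [->|_] /=; rewrite ?subrr// EFinB.
Qed.

(** Integrate the tangent inequality at the mean value [c] of [k] over []s, t]]; the left-hand side
    is [c ^ p * (t - s)]. *)
Lemma leb_Rintegral_powR_le T p k s t : 1 <= p ->
  (forall x, 0 <= k x) ->
  lam.-integrable `[0, T] (EFin \o k) ->
  lam.-integrable `[0, T] (fun x => (k x `^ p)%:E) ->
  0 <= s -> s < t -> t <= T ->
  (\int[lam]_(x in `]s, t]) k x) `^ p / (t - s) `^ (p - 1) <=
  \int[lam]_(x in `]s, t]) (k x `^ p).
Proof.
move=> p1 k0 intk intkp s0 st tT.
have mD := @leb_measurable_itv R `]s, t].
have sub : `]s, t]%classic `<=` `[0, T]%classic.
  by move=> x /=; rewrite !in_itv/= => /andP[sx xt]; apply/andP; lra.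
have st0 : 0 < t - s by rewrite subr_gt0.
have {}intk : lam.-integrable `]s, t] (EFin \o k).
  by apply: integrableS intk => //; exact: leb_measurable_itv.
have {}intkp : lam.-integrable `]s, t] (EFin \o (fun x => k x `^ p)).
  by apply: integrableS intkp => //; exact: leb_measurable_itv.
have intc (r : R) : lam.-integrable `]s, t] (EFin \o cst r).
  apply/integrableP; split.
    exact/measurable_EFinP/measurable_cst.
  rewrite (_ : (\int[_]_(x in _) _ = \int[lam]_(x in `]s, t]) `|r|%:E)%E)//.
  by rewrite integral_cst// leb_itvoc ?(ltW st)// ltry.
pose I := \int[lam]_(x in `]s, t]) k x; pose c := I / (t - s).
have I0 : 0 <= I by apply: Rintegral_ge0 => x _.
have c0 : 0 <= c by rewrite divr_ge0// ltW.
have IE : I = c * (t - s) by rewrite divfK// gt_eqF.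
have Dcst r : \int[lam]_(x in `]s, t]) r = r * (t - s).
  by rewrite Rintegral_cst//; congr (_ * _); rewrite leb_itvoc ?ltW.
have p0 : 0 < p by exact: lt_le_trans p1.
have : \int[lam]_(x in `]s, t]) ((p * c `^ (p - 1)) * k x) <=
       \int[lam]_(x in `]s, t]) (k x `^ p + (p - 1) * c `^ p).
  apply: le_Rintegral => //.
  - by apply: eq_integrable (integrableZl mD (p * c `^ (p - 1)) intk).
  - by apply: eq_integrable (integrableD mD intkp (intc ((p - 1) * c `^ p))).
  - by move=> x _; rewrite -mulrA; exact: powR_ge_tangent.
rewrite RintegralZl//.
rewrite (RintegralD mD intkp (intc ((p - 1) * c `^ p))).
rewrite (Dcst ((p - 1) * c `^ p)) -/I IE.
(* As [c ^ (p - 1) * c = c ^ p], [H] bounds [p] copies of [c ^ p * (t - s)] by the integral of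
   [k ^ p] plus [p - 1] such copies. *)
rewrite -mulrA -mulrA [c `^ (p - 1) * _]mulrA powR_subr1M// => H.
rewrite powRM ?(ltW st0)// -[(t - s) `^ p]powR_subr1M ?(ltW st0)//.
have P0 : (t - s) `^ (p - 1) != 0 by rewrite gt_eqF// powR_gt0.
rewrite [leLHS](_ : _ = c `^ p * (t - s)); first lra.
by field.
Qed.
End jensen.

(** * Riesz variation of primitives *)

Section primitive_BVp.
Context {R : realType} {d : nat}.
Local Notation lam := (@leb R).
Implicit Types (phi : R -> 'rV[R]_d) (T p s t : R).

Lemma ext0_val T (f : itv0 T -> 'rV[R]_d) (u : itv0 T) : ext0 f (val u) = f u.
Proof. exact: (congr1 (fun g => g u) (valLK 0 f)). Qed.

Lemma ext0_primitive T (f : itv0 T -> 'rV[R]_d) x0 phi :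
  (forall u, f u = x0 + vint phi (val u)) ->
  forall t, 0 <= t -> t <= T -> ext0 f t = x0 + vint phi t.
Proof.
move=> fE t t0 tT.
have tI : t \in itv0 T by apply/mem_set; rewrite /itv0 /= in_itv/= t0.
by rewrite -[t]/(val (SigSub tI : itv0 T)) ext0_val fE.
Qed.

Lemma vint_sub T p phi s t i : 1 <= p -> Lp_vec_on T p phi ->
  0 <= s -> s <= t -> t <= T ->
  (vint phi t - vint phi s) 0 i = \int[lam]_(x in `]s, t]) (phi x 0 i).
Proof.
move=> p1 phip s0 st tT; rewrite !mxE.
apply: (@leb_Rintegral_itvB _ (fun x => phi x 0 i) T) => //.
exact: Lp_vec_on_coord_integrable phip.
Qed.

Lemma vint_sub_coord_le T p phi (g : R -> R) s t i : 1 <= p ->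
  Lp_vec_on T p phi -> Lp_on T p g ->
  {ae lam, forall x, `[0, T]%classic x -> enorm (phi x) <= g x} ->
  0 <= s -> s <= t -> t <= T ->
  `|(vint phi t - vint phi s) 0 i| <= \int[lam]_(x in `]s, t]) g x.
Proof.
move=> p1 phip gp phig s0 st tT; rewrite (vint_sub i p1 phip s0 st tT).
have mD := @leb_measurable_itv R `]s, t].
have sub : `]s, t]%classic `<=` `[0, T]%classic.
  by move=> x /=; rewrite !in_itv/= => /andP[sx xt]; apply/andP; lra.
have intS (k : R -> R) : lam.-integrable `[0, T] (EFin \o k) ->
    lam.-integrable `]s, t] (EFin \o k).
  by apply: integrableS => //; exact: leb_measurable_itv.
have inti : lam.-integrable `]s, t] (EFin \o (fun x => phi x 0 i)).
  exact/intS/(Lp_vec_on_coord_integrable _ p1).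
have intg := Lp_on_integrable p1 gp.
apply: le_trans (le_normr_Rintegral mD inti) _.
(* Equal to [g] almost everywhere, [k] turns the almost everywhere bound into a pointwise one. *)
pose k x := Num.max (g x) `|phi x 0 i|.
have gk : {ae lam, forall x, `[0, T]%classic x -> g x = k x}.
  apply: leb_ae_sub phig => x /[apply] xg; rewrite /k max_l//.
  exact: le_trans (coord_le_enorm _ _) xg.
rewrite (@leb_ae_eq_integral _ `]s, t] g k)//; last 2 first.
- by apply: leb_ae_sub gk => x gk /sub/gk.
- by apply/measurable_EFinP; exact: measurable_int (intS _ intg).
apply: le_Rintegral => //; first exact: integrable_norm.
- by apply/intS/(leb_ae_eq_integrable _ gk intg); exact: leb_measurable_itv.
- by move=> x _; rewrite /k le_max lexx orbT.
Qed.

(** The factor [d] comes from bounding the norm by the sum of the coordinates; it is harmless for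
    the finiteness of the variation. *)
Lemma enorm_vint_sub_le T p phi s t : 1 <= p -> Lp_vec_on T p phi ->
  0 <= s -> s <= t -> t <= T ->
  enorm (vint phi t - vint phi s) <=
  \int[lam]_(x in `]s, t]) (d%:R * enorm (phi x)).
Proof.
move=> p1 phip s0 st tT; have [_ ep] := phip.
apply: le_trans (enorm_le_sum _) _.
have sub : `]s, t]%classic `<=` `[0, T]%classic.
  by move=> x /=; rewrite !in_itv/= => /andP[sx xt]; apply/andP; lra.
rewrite RintegralZl; last 2 first.
- exact: leb_measurable_itv.
- apply: integrableS (Lp_on_integrable p1 ep) => //; exact: leb_measurable_itv.
rewrite mulr_natl -[X in _ *+ X](card_ord d) -sumr_const.
apply: ler_sum => i _; apply: (vint_sub_coord_le i p1 phip ep) => //.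
by apply: aeW => x _.
Qed.

(** By Jensen's inequality each term of a Riesz sum is at most an increment of [K], the primitive of
    [k ^ p]. These increments telescope to a bound independent of the partition. *)
Lemma primitive_BVp T p (f : itv0 T -> 'rV[R]_d) x0 phi : 1 <= p ->
  Lp_vec_on T p phi -> (forall u, f u = x0 + vint phi (val u)) -> BVp p f.
Proof.
move=> p1 phip fE; have [_ ep] := phip.
pose k x := d%:R * enorm (phi x).
have k0 x : 0 <= k x by rewrite mulr_ge0// enorm_ge0.
have kp : Lp_on T p k by exact: Lp_on_scale.
have [_ intkp'] := (Lp_onP T k p1).1 kp.
have intkp : lam.-integrable `[0, T] (EFin \o (fun x => k x `^ p)).
  apply: eq_integrable intkp' => [|x _ /=]; first exact: leb_measurable_itv.
  by rewrite ger0_norm.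
have intk := Lp_on_integrable p1 kp.
pose K t := \int[lam]_(x in `[0, t]) (k x `^ p).
rewrite /BVp /=.
apply: (@le_lt_trans _ _ (K T - K 0)%:E); last exact: ltry.
apply: ge_ereal_sup => _ [s sP <-]; rewrite lee_fin /riesz_sum.
pose t := nth 0 (0 :: s).
have tT m : (m <= size s)%N -> 0 <= t m <= T.
  move=> ms; rewrite /t (set_nth_default T)//.
  by rewrite (itv_partition_nth_ge _ sP)// (itv_partition_nth_le _ sP).
have tm m : (m < size s)%N -> t m < t m.+1.
  by move=> ms; have [/(pathP 0)/(_ _ ms)] := sP.
have -> : K T = K (t (size s)) by rewrite /t (itv_partition_nth_size _ sP).
rewrite -[K 0]/(K (t 0%N)) -(@telescope_sumr _ 0 (size s) (K \o t))// big_mkord.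
apply: ler_sum => -[m /= ms] _.
have /andP[m0 mT] := tT m (ltnW ms).
have /andP[m10 m1T] := tT m.+1 ms.
rewrite -/(t m) -/(t m.+1) !(ext0_primitive fE)// opprD addrACA subrr add0r.
rewrite (leb_Rintegral_itvB intkp)//; last exact/ltW/tm.
apply: le_trans (leb_Rintegral_powR_le p1 k0 intk intkp m0 (tm _ ms) m1T).
rewrite ler_pM2r ?invr_gt0 ?powR_gt0 ?subr_gt0 ?tm//.
apply: ge0_ler_powR; [exact: le_trans p1|by rewrite nnegrE enorm_ge0| |].
  by rewrite nnegrE; apply: Rintegral_ge0 => x _.
exact: (enorm_vint_sub_le p1 phip m0 (ltW (tm _ ms)) m1T).
Qed.
End primitive_BVp.

(** * Support functions *)

Section support_function.
Context {R : realType} {d : nat}.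
Local Notation lam := (@leb R).
Implicit Types (A : set 'rV[R]_d) (u a : 'rV[R]_d) (Phi : R -> set 'rV[R]_d).
Implicit Types (g : R -> R) (T p : R).

Definition support_fun A u : R := sup [set dotp u a | a in A].

Lemma compact_has_sup_dotp A u : A !=set0 -> compact A ->
  has_sup [set dotp u a | a in A].
Proof.
move=> A0 cA; split; first by have [a Aa] := A0; exists (dotp u a), a.
have /(compact_EVT_max A0 cA)[b _ bmax] : {within A, continuous (dotp u)}.
  by apply: continuous_subspaceT; exact: continuous_dotp.
by exists (dotp u b) => _ [a Aa <-]; apply: bmax; exact: mem_set.
Qed.

Lemma dotp_le_support_fun A u a : compact A -> A a -> dotp u a <= support_fun A u.
Proof.
move=> cA Aa; apply: ub_le_sup; last by exists a.
by have [] := compact_has_sup_dotp u (ex_intro _ a Aa) cA.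
Qed.

Lemma norm_dotp_le u a : `|dotp u a| <= (\sum_(i < d) `|u 0 i|) * enorm a.
Proof.
apply: le_trans (ler_norm_sum _ _ _) _; rewrite mulr_suml.
by apply: ler_sum => i _; rewrite normrM ler_wpM2l// coord_le_enorm.
Qed.

Lemma norm_support_fun_le A u (c : R) : A !=set0 -> compact A ->
  (forall a, A a -> enorm a <= c) ->
  `|support_fun A u| <= (\sum_(i < d) `|u 0 i|) * c.
Proof.
move=> A0 cA Ac.
have dc a : A a -> `|dotp u a| <= (\sum_(i < d) `|u 0 i|) * c.
  move=> /Ac ac; apply: le_trans (norm_dotp_le _ _) _.
  by rewrite ler_wpM2l// sumr_ge0.
rewrite ler_norml; apply/andP; split.
  have [a Aa] := A0; apply: le_trans (dotp_le_support_fun u cA Aa).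
  by have := dc _ Aa; rewrite ler_norml => /andP[].
apply: ge_sup => [|_ [a Aa <-]]; first by have [] := compact_has_sup_dotp u A0 cA.
exact: le_trans (ler_norm _) (dc _ Aa).
Qed.

(** The support function exceeds [c] exactly where [Phi t] meets the open half-space
    [c < dotp u a]. *)
Lemma measurable_support_fun T Phi u :
  (forall t, itv0 T t -> Conv (Phi t)) -> set_measurable T Phi ->
  @measurable_fun _ _ (lebesgueType R) R `[0, T]
    (fun t => support_fun (Phi t) u).
Proof.
move=> PhiC mPhi mI; apply: (measurability _ (RGenOInfty.measurableE R)) => //.
move=> _ [_ [c ->] <-].
rewrite (_ : _ `&` _ = [set t | itv0 T t /\
    Phi t `&` [set a | c < dotp u a] !=set0]).
  apply: mPhi; rewrite -[X in open X]/(dotp u @^-1` [set y | c < y]).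
  apply: open_comp; last exact: open_gt.
  by move=> a _; exact: continuous_dotp.
apply/seteqP; split=> [t [tT /=]|t [tT [a [Pa /= ca]]]].
  have [P0 cP _] := PhiC t tT; rewrite in_itv/= andbT.
  move=> /sup_gt; case; first by have [] := compact_has_sup_dotp u P0 cP.
  by move=> _ [a Pa <-] ca; split => //; exists a.
have [P0 cP _] := PhiC t tT.
split => //=; rewrite in_itv/= andbT; apply: lt_le_trans ca _.
exact: dotp_le_support_fun.
Qed.

Lemma support_fun_integrable T Phi g u :
  (forall t, itv0 T t -> Conv (Phi t)) -> set_measurable T Phi ->
  lam.-integrable `[0, T] (EFin \o g) ->
  {ae lam, forall t, itv0 T t -> forall a, Phi t a -> enorm a <= g t} ->
  lam.-integrable `[0, T] (EFin \o (fun t => support_fun (Phi t) u)).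
Proof.
move=> PhiC mPhi intg Phig.
apply: (@leb_ae_le_integrable _ T _ (fun t => (\sum_(i < d) `|u 0 i|) * g t)).
- exact: measurable_support_fun.
- apply: leb_ae_sub Phig => t Phig tT; have [P0 cP _] := PhiC t tT.
  by apply: norm_support_fun_le => //; exact: Phig.
- apply: eq_integrable (integrableZl _ (\sum_(i < d) `|u 0 i|) intg) => //;
    exact: leb_measurable_itv.
Qed.

End support_function.

(** * Integrals of finite sums and scalar products *)

Section integral_dotp.
Context {R : realType}.
Local Notation lam := (@leb R).

Lemma Rintegral_sum d' (S : measurableType d') (mu : {measure set S -> \bar R})
    (D : set S) (I : Type) (s : seq I) (h : I -> S -> R) :
  measurable D -> (forall i, mu.-integrable D (EFin \o h i)) ->
  mu.-integrable D (EFin \o (fun x => \sum_(i <- s) h i x)) /\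
  \int[mu]_(x in D) (\sum_(i <- s) h i x) = \sum_(i <- s) \int[mu]_(x in D) h i x.
Proof.
move=> mD hi; elim: s => [|i s [ihi ih]].
  have -> : (fun x => \sum_(i <- [::]) h i x) = cst 0.
    by apply/funext => x; rewrite big_nil.
  rewrite big_nil; split; first exact: integrable0.
  by rewrite Rintegral_cst// mul0r.
have -> : (fun x => \sum_(j <- i :: s) h j x) =
    (fun x => h i x + \sum_(j <- s) h j x).
  by apply/funext => x; rewrite big_cons.
rewrite big_cons RintegralD//; split; last by rewrite ih.
by apply: eq_integrable (integrableD mD (hi i) ihi).
Qed.

Lemma integral_dotp {d : nat} (phi : R -> 'rV[R]_d) (u : 'rV[R]_d)
    (D : set (lebesgueType R)) : measurable D ->
  (forall i, lam.-integrable D (fun t => (phi t 0 i)%:E)) ->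
  lam.-integrable D (EFin \o (fun t => dotp u (phi t))) /\
  \int[lam]_(t in D) dotp u (phi t) =
  dotp u (\row_i \int[lam]_(t in D) (phi t 0 i)).
Proof.
move=> mD phii.
have hi i : lam.-integrable D (EFin \o (fun t => u 0 i * phi t 0 i)).
  by apply: eq_integrable (integrableZl mD (u 0 i) (phii i)).
have [int_sum sumE] := Rintegral_sum (index_enum 'I_d) mD hi.
split => //; rewrite sumE; apply: eq_bigr => i _.
by rewrite mxE; exact: (RintegralZl (u 0 i) mD (phii i)).
Qed.
End integral_dotp.

Section leb_ae_countable.
Context {R : realType}.

(** Serves to choose one null set for all rational functionals, and one for all coordinates. *)
Lemma leb_ae_forall_countable (I : countType) (P : I -> R -> Prop) :
  (forall i, {ae @leb R, forall x, P i x}) ->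
  {ae @leb R, forall x, forall i, P i x}.
Proof.
move=> aeP.
have H : {ae @leb R, forall x, forall n,
    if unpickle n is Some i then P i x else True}.
  apply: ae_foralln => n; case: unpickle => [i|]; first exact: aeP.
  exact: aeW.
by apply: leb_ae_sub H => x Hx i; have := Hx (pickle i); rewrite pickleK.
Qed.
End leb_ae_countable.

(** * Closedness *)

Section integral_closed.
Context {R : realType} {d : nat}.
Local Notation lam := (@leb R).
Implicit Types (phi psi : R -> 'rV[R]_d) (Phi : R -> set 'rV[R]_d).
Implicit Types (g : R -> R) (T p : R).

(** The right-hand side of the equation in [is_integral], for fixed witnesses [x0] and [Phi]. *)
Definition primitives T p (x0 : 'rV[R]_d) Phi : set (itv0 T -> 'rV[R]_d) :=
  [set f | BVp p f /\ exists2 phi, S_Lp T p Phi phi &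
                        forall t, f t = x0 + vint phi (val t)].

Lemma vint0 phi : vint phi 0 = 0.
Proof.
apply/rowP => i; rewrite !mxE set_itv1 /Rintegral null_set_integral.
- by [].
- by rewrite -set_itv1; exact: leb_measurable_itv.
- exact: measurable_fun_set1.
- exact: (@lebesgue_measure_set1 R).
Qed.

Lemma selection_le T Phi g phi :
  {ae lam, forall t, itv0 T t -> forall a, Phi t a -> enorm a <= g t} ->
  {ae lam, forall t, itv0 T t -> Phi t (phi t)} ->
  {ae lam, forall t, `[0, T]%classic t -> enorm (phi t) <= g t}.
Proof.
by apply: leb_ae_sub2 => t H1 H2 tT; exact: H1 tT _ (H2 tT).
Qed.

Lemma Lp_vec_on_dotp_integrable T p phi (u : 'rV[R]_d) : 1 <= p ->
  Lp_vec_on T p phi ->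
  lam.-integrable `[0, T] (EFin \o (fun t => dotp u (phi t))).
Proof.
move=> p1 phip; apply: (integral_dotp u _ _).1.
  exact: leb_measurable_itv.
by move=> i; exact: Lp_vec_on_coord_integrable phip.
Qed.

Lemma dotp_vint_sub T phi (u : 'rV[R]_d) s t :
  (forall i, lam.-integrable `[0, T] (fun t => (phi t 0 i)%:E)) ->
  0 <= s -> s <= t -> t <= T ->
  dotp u (vint phi t - vint phi s) = \int[lam]_(x in `]s, t]) dotp u (phi x).
Proof.
move=> phii s0 st tT; have mD := @leb_measurable_itv R `]s, t].
have sub : `]s, t]%classic `<=` `[0, T]%classic.
  by move=> x /=; rewrite !in_itv/= => /andP[sx xt]; apply/andP; lra.
rewrite (integral_dotp u mD _).2 => [|i]; last first.
  by apply: integrableS (phii i) => //; exact: leb_measurable_itv.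
congr dotp; apply/rowP => i; rewrite !mxE.
exact: (leb_Rintegral_itvB (k := fun x => phi x 0 i) (phii i)).
Qed.

(** Expresses membership in [Phi] through increments of the primitive alone, with a bound common to
    all selections; this form survives uniform limits. *)
Lemma dotp_vint_sub_le_support_fun T p Phi g phi (u : 'rV[R]_d) s t : 1 <= p ->
  (forall t, itv0 T t -> Conv (Phi t)) -> set_measurable T Phi ->
  lam.-integrable `[0, T] (EFin \o g) ->
  {ae lam, forall t, itv0 T t -> forall a, Phi t a -> enorm a <= g t} ->
  S_Lp T p Phi phi -> 0 <= s -> s <= t -> t <= T ->
  dotp u (vint phi t - vint phi s) <=
  \int[lam]_(x in `]s, t]) support_fun (Phi x) u.
Proof.
move=> p1 PhiC mPhi intg Phig [phip phiPhi] s0 st tT.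
have mD := @leb_measurable_itv R `]s, t].
have mI := @leb_measurable_itv R `[0, T].
have sub : `]s, t]%classic `<=` `[0, T]%classic.
  by move=> x /=; rewrite !in_itv/= => /andP[sx xt]; apply/andP; lra.
rewrite (dotp_vint_sub u (fun i => Lp_vec_on_coord_integrable i p1 phip))//.
have intd := Lp_vec_on_dotp_integrable u p1 phip.
have intsu := support_fun_integrable u PhiC mPhi intg Phig.
pose k x := Num.max (support_fun (Phi x) u) (dotp u (phi x)).
have sk : {ae lam, forall x, `[0, T]%classic x -> support_fun (Phi x) u = k x}.
  apply: leb_ae_sub phiPhi => x xPhi xT; rewrite /k max_l//.
  by apply: dotp_le_support_fun; [have [] := PhiC x xT|exact: xPhi].
rewrite (@leb_ae_eq_integral _ `]s, t] (fun x => support_fun (Phi x) u) k mD).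
- apply: le_Rintegral => //.
  + exact: integrableS intd.
  + by apply: integrableS (leb_ae_eq_integrable mI sk intsu).
  + by move=> x _; rewrite /k le_max lexx orbT.
- by apply: leb_ae_sub sk => x sk /sub/sk.
- apply/measurable_EFinP; apply: measurable_int.
  exact: integrableS intsu.
Qed.

Lemma Lp_vec_on_density T p g (F : R -> 'rV[R]_d) : 0 <= T -> 1 <= p ->
  Lp_on T p g ->
  (forall i s t, 0 <= s -> s <= t -> t <= T ->
     `|F t 0 i - F s 0 i| <= \int[lam]_(x in `]s, t]) g x) ->
  exists2 psi : R -> 'rV[R]_d,
    (forall i, lam.-integrable setT (fun x => (psi x 0 i)%:E)) &
    forall t, 0 <= t -> t <= T -> F t = F 0 + vint psi t.
Proof.
move=> T0 p1 gp Fg; have intg := Lp_on_integrable p1 gp.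
have mI := @leb_measurable_itv R `[0, T].
pose gT : lebesgueType R -> R := g \_ `[0, T].
have intgT : lam.-integrable setT (EFin \o gT).
  by move/(integrable_mkcond _ mI) : intg; rewrite restrict_EFin.
have /choice[psi psiE] i : exists psi : R -> R,
    lam.-integrable setT (EFin \o psi) /\ forall t, 0 <= t -> t <= T ->
      F t 0 i = F 0 0 i + \int[lam]_(x in `[0, t]) psi x.
  have [|psi ? ?] := @leb_itv_density _ gT (fun t => F t 0 i) _ T0 intgT.
    move=> s t s0 st tT; rewrite (@eq_Rintegral _ _ _ lam _ g).
      exact: Fg.
    move=> x; rewrite inE /= in_itv/= => /andP[sx xt].
    by rewrite /gT patchE mem_set//= in_itv/=; apply/andP; lra.
  by exists psi.
exists (fun x => \row_i psi i x).
  move=> i; have [+ _] := psiE i; apply: eq_integrable => // x _.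
  by rewrite /= mxE.
move=> t t0 tT; apply/rowP => i; have [_ ->//] := psiE i.
by rewrite !mxE; congr (_ + _); apply: eq_Rintegral => x _; rewrite mxE.
Qed.

Lemma dist_le_near (x y a b c e r : R) :
  `|x - (c + a)| <= e -> `|y - (c + b)| <= e -> `|a - b| <= r ->
  `|x - y| <= r + (e + e).
Proof.
by rewrite !ler_norml => /andP[? ?] /andP[? ?] /andP[? ?]; apply/andP; lra.
Qed.

(** The constants cancel in the difference; in the use below they are the products of [u] with [x0]
    and with [F 0]. *)
Lemma sub_le_near (x y a b c c' e r : R) :
  `|c' + x - (c + a)| <= e -> `|c' + y - (c + b)| <= e -> a - b <= r ->
  x - y <= r + (e + e).
Proof. by rewrite !ler_norml => /andP[? ?] /andP[? ?]; lra. Qed.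

Lemma closed_primitives T p x0 Phi g : 0 <= T -> 1 <= p ->
  (forall t, itv0 T t -> Conv (Phi t)) -> set_measurable T Phi ->
  Lp_on T p g ->
  {ae lam, forall t, itv0 T t -> forall a, Phi t a -> enorm a <= g t} ->
  closed_sup_norm (primitives p x0 Phi : set (itv0 T -> 'rV[R]_d)).
Proof.
move=> T0 p1 PhiC mPhi gp Phig f fcl; pose F := ext0 f.
have intg := Lp_on_integrable p1 gp.
have mI := @leb_measurable_itv R `[0, T].
have FH e : 0 < e -> exists2 phi, S_Lp T p Phi phi &
    forall t, 0 <= t -> t <= T -> enorm (F t - (x0 + vint phi t)) < e.
  move=> e0; have [h [_ [phi phiS hE]] fh] := fcl e e0.
  exists phi => // t t0 tT; rewrite -lte_fin; apply: le_lt_trans fh.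
  apply: ereal_sup_ubound.
  have tI : t \in itv0 T by apply/mem_set; rewrite /itv0 /= in_itv/= t0.
  exists (SigSub tI : itv0 T) => //; rewrite hE.
  by rewrite -[F t]/(ext0 f (val (SigSub tI : itv0 T))) ext0_val.
have F0 : F 0 = x0.
  apply/rowP => i; apply/eqP; rewrite -subr_eq0 -normr_le0.
  apply/ler_addgt0Pr => e e0; rewrite add0r.
  have [phi _ /(_ 0 (lexx _) T0)] := FH e e0.
  rewrite vint0 addr0 => /ltW; apply: le_trans.
  by apply: le_trans (coord_le_enorm _ i); rewrite !mxE.
(* The bound by [g] is common to all approximating primitives, so it passes to the limit as the
   error tends to zero. *)
have Fg i s t : 0 <= s -> s <= t -> t <= T ->
    `|F t 0 i - F s 0 i| <= \int[lam]_(x in `]s, t]) g x.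
  move=> s0 st tT; apply/ler_addgt0Pr => e e0.
  have e20 : 0 < e / 2 by rewrite divr_gt0.
  have [phi [phip phiPhi] Fphi] := FH _ e20.
  have := vint_sub_coord_le i p1 phip gp (selection_le Phig phiPhi) s0 st tT.
  have := le_lt_trans (coord_le_enorm _ i) (Fphi t (le_trans s0 st) tT).
  have := le_lt_trans (coord_le_enorm _ i) (Fphi s s0 (le_trans st tT)).
  rewrite !mxE => Fs Ft FI; apply: le_trans (dist_le_near (ltW Ft) (ltW Fs) FI) _.
  by rewrite -splitr.
have [psi intpsi Fpsi] := Lp_vec_on_density T0 p1 gp Fg.
have intpsiT i : lam.-integrable `[0, T] (fun x => (psi x 0 i)%:E).
  by apply: integrableS (intpsi i).
have psi_le (q : 'rV[rat]_d) : {ae lam, forall t, itv0 T t ->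
    dotp (map_mx ratr q) (psi t) <= support_fun (Phi t) (map_mx ratr q)}.
  set u : 'rV[R]_d := map_mx ratr q.
  pose k t := support_fun (Phi t) u - dotp u (psi t).
  have intsu := support_fun_integrable u PhiC mPhi intg Phig.
  have intd : lam.-integrable `[0, T] (EFin \o (fun t => dotp u (psi t))).
    by apply: (integral_dotp u _ _).1.
  have intk : lam.-integrable `[0, T] (EFin \o k).
    by apply: eq_integrable (integrableB mI intsu intd).
  pose kT : lebesgueType R -> R := k \_ `[0, T].
  have intkT : lam.-integrable setT (EFin \o kT).
    by move/(integrable_mkcond _ mI) : intk; rewrite restrict_EFin.
  have /(leb_integral_ge0_ae intkT) : forall s t, 0 <= s -> s <= t -> t <= T ->
      0 <= \int[lam]_(x in `]s, t]) kT x.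
    move=> s t s0 st tT.
    have mD := @leb_measurable_itv R `]s, t].
    have sub : `]s, t]%classic `<=` `[0, T]%classic.
      by move=> x /=; rewrite !in_itv/= => /andP[sx xt]; apply/andP; lra.
    rewrite (@eq_Rintegral _ _ _ lam _ k); last first.
      by move=> x /set_mem/sub xT; rewrite /kT patchE mem_set.
    rewrite RintegralB//; [|exact: integrableS intsu|exact: integrableS intd].
    rewrite -(dotp_vint_sub u intpsiT)// subr_ge0.
    set C := \sum_(i < d) `|u 0 i|.
    have C0 : 0 <= C by exact: sumr_ge0.
    apply/ler_addgt0Pr => e e0.
    (* Pairing with [u] multiplies errors by at most [C], and each of the two end points may cost
       [e / 2]. The added [1] covers [C = 0]. *)
    have e'0 : 0 < e / 2 / (C + 1) by rewrite !divr_gt0// ltr_wpDl.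
    have e'E : C * (e / 2 / (C + 1)) <= e / 2.
      by rewrite mulrCA ger_pMr ?divr_gt0// ler_pdivrMr ?ltr_wpDl// mul1r lerDl.
    have [phi phiS Fphi] := FH _ e'0.
    have := dotp_vint_sub_le_support_fun u p1 PhiC mPhi intg Phig phiS s0 st tT.
    have close r : 0 <= r -> r <= T ->
        `|dotp u (F r) - dotp u (x0 + vint phi r)| <= e / 2.
      move=> r0 rT; rewrite -dotpBr; apply: le_trans (norm_dotp_le _ _) _.
      by apply: le_trans e'E; rewrite ler_wpM2l// ltW// Fphi.
    have := close _ s0 (le_trans st tT); have := close _ (le_trans s0 st) tT.
    rewrite (Fpsi t (le_trans s0 st) tT) (Fpsi s s0 (le_trans st tT)).
    rewrite !dotpBr !dotpDr => Ht Hs ?; rewrite [e]splitr.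
    exact: sub_le_near Ht Hs _.
  apply: leb_ae_sub => t kt tT; have := tT; rewrite /itv0 /= in_itv/= => /kt.
  by rewrite /kT patchE mem_set// subr_ge0.
have psiPhi : {ae lam, forall t, itv0 T t -> Phi t (psi t)}.
  apply: leb_ae_sub (leb_ae_forall_countable psi_le) => t Ht tT.
  have [P0 cP cvP] := PhiC t tT.
  by apply: convex_rat_separation => // q; exact: Ht.
(* Being a selection, [psi] is dominated by [g], which lifts its integrability to [L^p]. *)
have psip : Lp_vec_on T p psi.
  apply: (Lp_vec_on_le p1 _ (selection_le Phig psiPhi) gp) => i.
  apply/measurable_EFinP; exact: measurable_int (intpsiT i).
have fE u : f u = x0 + vint psi (val u).
  have := set_mem (valP u); rewrite /itv0 /= in_itv/= => /andP[u0 uT].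
  by rewrite -ext0_val -/F Fpsi// F0.
split; first exact: primitive_BVp fE.
by exists psi.
Qed.
End integral_closed.

(** * Decomposability *)

Section decomposable.
Context {R : realType} {d : nat}.
Local Notation lam := (@leb R).
Implicit Types (phi : R -> 'rV[R]_d) (Phi : R -> set 'rV[R]_d) (T p a : R).

Lemma ae_deriv_primitive T p (f : itv0 T -> 'rV[R]_d) x0 phi : 1 <= p ->
  Lp_vec_on T p phi -> (forall u, f u = x0 + vint phi (val u)) ->
  {ae lam, forall t, itv0 T t -> ae_deriv f t = phi t}.
Proof.
move=> p1 phip fE.
have mI := @leb_measurable_itv R `[0, T].
pose phiT i : lebesgueType R -> R := (fun t => phi t 0 i) \_ `[0, T].
have intphiT i : lam.-integrable setT (EFin \o phiT i).
  have /(integrable_mkcond _ mI) := Lp_vec_on_coord_integrable i p1 phip.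
  by rewrite restrict_EFin.
have n0T : {ae lam, forall t, t != 0 /\ t != T}.
  exact: leb_ae_sub2 (leb_ae_neq 0) (leb_ae_neq T).
apply: leb_ae_sub2 n0T (leb_ae_forall_countable (fun i => leb_FTC1 (intphiT i))).
move=> t [t0 tT] dphi; rewrite /itv0 /= in_itv/= => /andP[le0t letT].
have {t0} t_gt0 : 0 < t by rewrite lt_def t0.
have {tT} tltT : t < T by rewrite lt_def eq_sym tT.
(* [M] is built from globally integrable coordinates, so the differentiation theorem applies to it;
   near an interior point it coincides with [ext0 f]. *)
pose M (s : R) : 'rV[R]_d := \row_i (x0 0 i + \int[lam]_(y in `[0, s]) phiT i y).
have dM i : is_derive t (1 : R) (fun s => M s 0 i) (phi t 0 i).
  have [dK KE] := dphi i t_gt0.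
  rewrite (_ : (fun s => M s 0 i) =
    cst (x0 0 i) + (fun s => \int[lam]_(y in `[0, s]) phiT i y)); last first.
    by apply/funext => s; rewrite /M mxE.
  rewrite -[phi t 0 i]add0r; apply: is_deriveD; apply: DeriveDef => //.
  rewrite -derive1E KE /phiT patchE mem_set//= in_itv/= le0t; exact: letT.
have dMt : derivable M t 1.
  by apply/derivable_mxP => i j; rewrite ord1; have [] := dM j.
have nM : \forall s \near t, M s = ext0 f s.
  near=> s.
  have s0 : 0 < s by near: s; exact: lt_nbhsr.
  have sT : s < T by near: s; exact: lt_nbhsl.
  rewrite (ext0_primitive fE (ltW s0) (ltW sT)); apply/rowP => i; rewrite !mxE.
  congr (_ + _); apply: eq_Rintegral => y; rewrite inE /= in_itv/= => /andP[y0 ys].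
  by rewrite /phiT patchE mem_set//= in_itv/= y0 (le_trans ys (ltW sT)).
rewrite /ae_deriv derive1E -(near_eq_derive _ nM).
rewrite derive_mx//; apply/rowP => i; rewrite mxE.
by have [_ ->] := dM i.
Unshelve. all: by end_near. Qed.

Lemma Vp_decomposable_primitives T p x0 Phi (g : R -> R) : 0 <= T -> 1 <= p ->
  Lp_on T p g ->
  {ae lam, forall t, itv0 T t -> forall v, Phi t v -> enorm v <= g t} ->
  Vp_decomposable (primitives p x0 Phi : set (itv0 T -> 'rV[R]_d)).
Proof.
move=> T0 p1 gp Phig f1 f2 a [_ [phi1 [phi1p phi1Phi] f1E]].
move=> [_ [phi2 [phi2p phi2Phi] f2E]] aT.
(* The formula of [oplus] with the selections in place of the derivatives. *)
pose phi s := \1_(`[0, a[%classic : set R) s *: phi1 s +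
              \1_(`[a, T]%classic : set R) s *: phi2 s.
have phiE s : itv0 T s -> phi s = if s < a then phi1 s else phi2 s.
  rewrite /itv0 /= in_itv/= => /andP[s0 sT]; rewrite /phi !indicE.
  have [sa|sa] := ltP s a.
    rewrite mem_set/= ?in_itv/= ?s0//= memNset/= ?scale1r ?scale0r ?addr0//.
    by rewrite in_itv/= leNgt sa.
  rewrite memNset/= ?in_itv/= ?s0 ?ltNge ?sa// mem_set/= ?in_itv/= ?sa//.
  by rewrite scale1r scale0r add0r.
have mphi i : @measurable_fun _ _ (lebesgueType R) R `[0, T]
    (fun s => phi s 0 i).
  rewrite (_ : (fun s => _) = (fun s =>
      \1_(`[0, a[%classic : set R) s * phi1 s 0 i +
      \1_(`[a, T]%classic : set R) s * phi2 s 0 i)); last first.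
    by apply/funext => s; rewrite !mxE.
  have mind (j : interval R) : @measurable_fun _ _ (lebesgueType R) R `[0, T]
      (\1_([set` j] : set R) : R -> R).
    apply: (@measurable_funTS _ _ (lebesgueType R)).
    by apply: borel_leb_measurable_fun; exact: measurable_indic.
  have [m1 _] := phi1p; have [m2 _] := phi2p.
  by apply: measurable_funD; apply: measurable_funM;
    [exact: mind|exact: m1|exact: mind|exact: m2].
have phiPhi : {ae lam, forall t, itv0 T t -> Phi t (phi t)}.
  apply: leb_ae_sub2 phi1Phi phi2Phi => t P1 P2 tT; rewrite phiE//.
  by case: ifPn => _; [exact: P1|exact: P2].
have phip : Lp_vec_on T p phi.
  exact: (Lp_vec_on_le p1 mphi (selection_le Phig phiPhi) gp).
have fE u : oplus a f1 f2 u = x0 + vint phi (val u).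
  rewrite /oplus (ext0_primitive f1E (lexx 0) T0) vint0 addr0; congr (_ + _).
  have := set_mem (valP u); rewrite /itv0 /= in_itv/= => /andP[u0 uT].
  have sub : `[0, val u]%classic `<=` itv0 T.
    by move=> s; rewrite /itv0 /= !in_itv/= => /andP[-> /le_trans]; exact.
  (* The integrands agree almost everywhere because the derivatives of [f1] and [f2] are the
     selections there; measurability is known for [phi] and thereby holds for the other
     integrand. *)
  apply/rowP => i; rewrite !mxE; apply/esym/leb_ae_eq_integral.
  - exact: leb_measurable_itv.
  - apply: leb_ae_sub2 (ae_deriv_primitive p1 phi1p f1E)
      (ae_deriv_primitive p1 phi2p f2E) => s d1 d2 /sub su.
    by rewrite d1// d2.
  - by apply: measurable_funS (mphi i) => //; exact: leb_measurable_itv.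
split; first exact: primitive_BVp fE.
by exists phi.
Qed.

Lemma p_integrably_bounded_enorm T Phi (g : R -> R) :
  {ae lam, forall t, itv0 T t ->
     (ereal_sup [set (enorm a)%:E | a in Phi t] <= (g t)%:E)%E} ->
  {ae lam, forall t, itv0 T t -> forall v, Phi t v -> enorm v <= g t}.
Proof.
apply: leb_ae_sub => t H tT v Pv; rewrite -lee_fin; apply: le_trans (H tT).
by apply: ereal_sup_ubound; exists v.
Qed.
End decomposable.

Theorem theorem1 (R : realType) (T : R) (d : nat) (p : R)
    (Lam : set (itv0 T -> 'rV[R]_d)) :
  0 < T -> (1 <= d)%N -> 1 <= p ->
  is_integral p Lam ->
  closed_sup_norm Lam /\ Vp_decomposable Lam.
Proof.
move=> /ltW T0 _ p1 [x0 [Phi [PhiC mPhi [g [gp Phig]] ->]]].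
have {}Phig := p_integrably_bounded_enorm Phig.
split; first exact: (closed_primitives T0 p1 PhiC mPhi gp Phig).
exact: (Vp_decomposable_primitives T0 p1 gp Phig).
Qed.
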